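(* Let $\omega:\mathbb{N}_0\times\mathbb{N}_0\to\{-1,1\}$ be the twist function of any one of the eight Cayley-Dickson doubling products $P_0,P_1,P_2,P_3,P_0^\top,P_1^\top,P_2^\top,P_3^\top$. Let $p,q,k\in\mathbb{N}_0$ and let $N$ be a positive integer. If $2^{N-1}\le p<2^{N}\le q<2^{N+1}$ and $k\ge 0$, then $$\omega(p,q)=\omega(p,q+k2^N).$$
   Context: $\mathbb{N}_0$ is the set of non-negative integers. For $p,q\in\mathbb{N}_0$, $p\oplus q$ is the bitwise exclusive-or of their binary representations. Cayley-Dickson algebras. For $n\ge 0$, let $\mathbb{A}_n$ be the real vector space of real sequences $x=x_0,x_1,x_2,\dots$ with $x_i=0$ for all $i\ge 2^n$; thus $\mathbb{A}_n\subset\mathbb{A}_{n+1}$, and $\mathbb{A}_0=\mathbb{R}$ (a real number $x$ is identified with $x,0,0,\dots$). Put $\mathbb{A}=\bigcup_n\mathbb{A}_n$. An ordered pair $(a,b)$ of sequences is identified with the shuffled sequence $a_0,b_0,a_1,b_1,a_2,b_2,\dots$, so that $\mathbb{A}_{n+1}=\{(a,b): a,b\in\mathbb{A}_n\}$. The conjugate of $x$ is $x^*=x_0,-x_1,-x_2,\dots$; equivalently $(a,b)^*=(a^*,-b)$. Let $e_k$ ($k\ge0$) be the standard unit basis sequences ($1$ in position $k$, $0$ elsewhere); equivalently $e_0=1$, $e_{2k}=(e_k,0)$, $e_{2k+1}=(0,e_k)$ for $k\ge 0$. Doubling products. Each of the following eight formulas defines recursively a bilinear product on $\mathbb{A}$: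 on $\mathbb{A}_0=\mathbb{R}$ it is ordinary multiplication, and the product of two elements of $\mathbb{A}_{n+1}$ is given in terms of the product on $\mathbb{A}_n$ by $P_0$: $(a,b)(c,d)=(ca-b^*d,\ da^*+bc)$; $P_1$: $(a,b)(c,d)=(ca-db^*,\ a^*d+cb)$; $P_2$: $(a,b)(c,d)=(ac-b^*d,\ da^*+bc)$; $P_3$: $(a,b)(c,d)=(ac-db^*,\ a^*d+cb)$; $P_0^\top$: $(a,b)(c,d)=(ca-bd^*,\ ad+c^*b)$; $P_1^\top$: $(a,b)(c,d)=(ca-d^*b,\ da+bc^* )$; $P_2^\top$: $(a,b)(c,d)=(ac-bd^*,\ ad+c^*b)$; $P_3^\top$: $(a,b)(c,d)=(ac-d^*b,\ da+bc^* )$. Twist. For each of the eight products there is a unique function $\omega:\mathbb{N}_0\times\mathbb{N}_0\to\{-1,1\}$, called the twist of that product, such that $e_pe_q=\omega(p,q)\,e_{p\oplus q}$ for all $p,q\in\mathbb{N}_0$. *)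

(* Defs.v *)
From HB Require Import structures.
From mathcomp Require Import all_boot all_order all_algebra.
From mathcomp Require Import reals.

Set Implicit Arguments.
Unset Strict Implicit.
Unset Printing Implicit Defensive.

Import Order.TTheory GRing.Theory Num.Theory.
Local Open Scope ring_scope.

Variant doubling_product := P0 | P1 | P2 | P3 | P0T | P1T | P2T | P3T.

Section CayleyDickson.
Variable R : realType.

(* The space A of finitely supported real sequences. {poly R} is used only as
   the library's vector space of such sequences, x`_i being the i-th term (its
   ring product plays no role); x lies in A_n iff size x <= 2 ^ n. *)
Local Notation A := {poly R}.

Implicit Types (x y z a b c d : A) (P : doubling_product) (n p q : nat).

(* The ordered pair (a, b), i.e. the sequence a_0, b_0, a_1, b_1, ...; its
   components are recovered by even_poly and odd_poly. *)
Definition cd_pair a b : A :=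
  \poly_(i < (maxn (size a) (size b)).*2) (if odd i then b`_i./2 else a`_i./2).

Definition cd_conj x : A :=
  \poly_(i < size x) (if i == 0%N then x`_i else - x`_i).

Definition cd_basis k : A := 'X^k.

Section Doubling.
Variable mul : A -> A -> A.
Local Notation "x ** y" := (mul x y) (at level 40, left associativity).
Local Notation "x ^*" := (cd_conj x) : ring_scope.

Definition cd_double P a b c d : A :=
  match P with
  | P0  => cd_pair (c ** a - b^* ** d) (d ** a^* + b ** c)
  | P1  => cd_pair (c ** a - d ** b^*) (a^* ** d + c ** b)
  | P2  => cd_pair (a ** c - b^* ** d) (d ** a^* + b ** c)
  | P3  => cd_pair (a ** c - d ** b^*) (a^* ** d + c ** b)
  | P0T => cd_pair (c ** a - b ** d^*) (a ** d + c^* ** b)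
  | P1T => cd_pair (c ** a - d^* ** b) (d ** a + b ** c^*)
  | P2T => cd_pair (a ** c - b ** d^*) (a ** d + c^* ** b)
  | P3T => cd_pair (a ** c - d^* ** b) (d ** a + b ** c^*)
  end.

End Doubling.

(* The product on A_n, meaningful for x and y in A_n. *)
Fixpoint cd_mul_at P n x y : A :=
  if n is n'.+1 then
    cd_double (cd_mul_at P n') P
      (even_poly x) (odd_poly x) (even_poly y) (odd_poly y)
  else (x`_0 * y`_0)%:P.

(* The product on A, computed in the least A_n that contains both factors; by
   cd_mul_atE below, any such A_n gives the same result. *)
Definition cd_mul P x y : A :=
  cd_mul_at P (up_log 2 (maxn (size x) (size y))) x y.

Definition is_twist P (omega : nat -> nat -> R) : Prop :=
  forall p q : nat,
    (omega p q = 1 \/ omega p q = -1) /\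
    cd_mul P (cd_basis p) (cd_basis q) =
      omega p q *: cd_basis (Nat.lxor p q).

Lemma coef_cd_pair a b i :
  (cd_pair a b)`_i = if odd i then b`_i./2 else a`_i./2.
Proof.
rewrite coef_poly; case: ltnP => // le_i.
have le_h : (maxn (size a) (size b) <= i./2)%N.
  by rewrite -(doubleK (maxn _ _)) half_leq.
have [lea leb] := (leq_trans (leq_maxl _ _) le_h, leq_trans (leq_maxr _ _) le_h).
by rewrite !nth_default //; case: (odd i).
Qed.

Lemma even_cd_pair a b : even_poly (cd_pair a b) = a.
Proof.
by apply/polyP => i; rewrite coef_even_poly coef_cd_pair odd_double doubleK.
Qed.

Lemma odd_cd_pair a b : odd_poly (cd_pair a b) = b.
Proof.
apply/polyP => i; rewrite coef_odd_poly coef_cd_pair /= odd_double /=.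
by rewrite uphalf_double.
Qed.

Lemma cd_pairE x : cd_pair (even_poly x) (odd_poly x) = x.
Proof.
apply/polyP => i; rewrite coef_cd_pair coef_odd_poly coef_even_poly.
by rewrite -[in RHS](odd_double_half i); case: (odd i).
Qed.

Lemma coef_cd_conj x i : (cd_conj x)`_i = if i == 0%N then x`_i else - x`_i.
Proof.
rewrite coef_poly; case: ltnP => // le_i.
by rewrite nth_default // oppr0 if_same.
Qed.

Lemma cd_conj_pair a b : cd_conj (cd_pair a b) = cd_pair (cd_conj a) (- b).
Proof.
apply/polyP => i; rewrite coef_cd_conj !coef_cd_pair coefN coef_cd_conj.
by case: i => [|[|i]] //=; rewrite negbK; case: (odd i).
Qed.

Lemma cd_basis_double k : cd_basis k.*2 = cd_pair (cd_basis k) 0.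
Proof.
apply/polyP => i; rewrite coef_cd_pair coef0 !coefXn.
rewrite -{1}(odd_double_half i); case: (odd i) => /=; last first.
  by rewrite add0n (inj_eq double_inj).
by case: eqP => // /(congr1 odd); rewrite /= !odd_double.
Qed.

Lemma cd_basis_doubleS k : cd_basis k.*2.+1 = cd_pair 0 (cd_basis k).
Proof.
apply/polyP => i; rewrite coef_cd_pair coef0 !coefXn.
rewrite -{1}(odd_double_half i); case: (odd i) => /=; first last.
  by rewrite add0n; case: eqP => // /(congr1 odd); rewrite /= !odd_double.
by rewrite add1n eqSS (inj_eq double_inj).
Qed.

Lemma cd_conj0 : cd_conj 0 = 0.
Proof. by apply/polyP => i; rewrite coef_cd_conj coef0 oppr0 if_same. Qed.

Lemma cd_conjD x y : cd_conj (x + y) = cd_conj x + cd_conj y.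
Proof.
by apply/polyP => i; rewrite !(coefD, coef_cd_conj) opprD; case: ifP.
Qed.

Lemma cd_conjZ (r : R) x : cd_conj (r *: x) = r *: cd_conj x.
Proof.
by apply/polyP => i; rewrite !(coefZ, coef_cd_conj) -mulrN; case: ifP.
Qed.

Lemma cd_pair0 : cd_pair 0 0 = 0.
Proof. by apply/polyP => i; rewrite coef_cd_pair !coef0 if_same. Qed.

Lemma cd_pairD a b c d : cd_pair (a + c) (b + d) = cd_pair a b + cd_pair c d.
Proof.
by apply/polyP => i; rewrite !(coefD, coef_cd_pair); case: (odd i).
Qed.

Lemma cd_pairZ (r : R) a b : cd_pair (r *: a) (r *: b) = r *: cd_pair a b.
Proof.
by apply/polyP => i; rewrite !(coefZ, coef_cd_pair); case: (odd i).
Qed.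

Lemma cd_mul_at_bilinear P n (r : R) x x' y :
    cd_mul_at P n (r *: x + x') y = r *: cd_mul_at P n x y + cd_mul_at P n x' y
  /\
    cd_mul_at P n y (r *: x + x') = r *: cd_mul_at P n y x + cd_mul_at P n y x'.
Proof.
elim: n => [|n IHn] /= in x x' y *.
  rewrite coefD coefZ mulrDl mulrDr !polyCD -!mul_polyC -!polyCM.
  by rewrite !mulrA [y`_0 * r]mulrC.
have Hl u u' v := proj1 (IHn u u' v); have Hr u u' v := proj2 (IHn u u' v).
rewrite !linearP /=; split; rewrite /cd_double; case: P {IHn} Hl Hr => Hl Hr;
  rewrite ?(cd_conjD, cd_conjZ) ?Hl ?Hr -cd_pairZ -cd_pairD;
  by congr cd_pair; rewrite ?(scalerDr, scalerN, opprD) addrACA.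
Qed.

Lemma size_even_poly_exp n x :
  (size x <= 2 ^ n.+1)%N -> (size (even_poly x) <= 2 ^ n)%N.
Proof.
move=> le_x; apply: leq_trans (size_even_poly _) _.
by rewrite leq_uphalf_double -mul2n -expnS.
Qed.

Lemma size_odd_poly_exp n x :
  (size x <= 2 ^ n.+1)%N -> (size (odd_poly x) <= 2 ^ n)%N.
Proof.
move=> le_x; apply: leq_trans (size_odd_poly _) _.
by rewrite -(doubleK (2 ^ n)%N) half_leq // -mul2n -expnS.
Qed.

Lemma cd_mul_atS P n x y : (size x <= 2 ^ n)%N -> (size y <= 2 ^ n)%N ->
  cd_mul_at P n.+1 x y = cd_mul_at P n x y.
Proof.
elim: n x y => [|n IHn] x y szx szy.
  have [-> ->] := (size1_polyC szx, size1_polyC szy).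
  rewrite /= !even_polyC !odd_polyC /cd_double.
  by case: P; rewrite !(cd_conj0, coef0, mul0r, mulr0, addr0, subr0, coefC) /=
    ?[y`_0 * _]mulrC -[RHS]cd_pairE even_polyC odd_polyC.
have szE := size_even_poly_exp; have szO := size_odd_poly_exp.
have szC z : (size (cd_conj z) <= size z)%N by exact: size_poly.
have szCE z : (size z <= 2 ^ n.+1)%N -> (size (cd_conj (even_poly z)) <= 2 ^ n)%N.
  by move=> szz; apply: leq_trans (szC _) (szE _ _ szz).
have szCO z : (size z <= 2 ^ n.+1)%N -> (size (cd_conj (odd_poly z)) <= 2 ^ n)%N.
  by move=> szz; apply: leq_trans (szC _) (szO _ _ szz).
rewrite [LHS]/= [RHS]/= -/(cd_mul_at P n.+1).
by case: P IHn => IHn; rewrite /cd_double !IHn; auto.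
Qed.

Lemma cd_mul_atE P n x y : (size x <= 2 ^ n)%N -> (size y <= 2 ^ n)%N ->
  cd_mul_at P n x y = cd_mul P x y.
Proof.
move=> szx szy; rewrite /cd_mul; set m := up_log _ _.
have le_mn : (m <= n)%N by rewrite up_log_min // geq_max szx.
have: (maxn (size x) (size y) <= 2 ^ m)%N by apply: up_logP.
rewrite geq_max => /andP[mx my]; rewrite -(subnK le_mn).
elim: (n - m)%N => // k IHk; rewrite addSn cd_mul_atS //;
  apply: leq_trans (_ : 2 ^ m <= _)%N; by rewrite // leq_exp2l // leq_addl.
Qed.

Lemma cd_mulC P (r s : R) : cd_mul P r%:P s%:P = (r * s)%:P.
Proof.
by rewrite -(@cd_mul_atE _ 0) ?size_polyC_leq1 //= !coefC.
Qed.

Lemma cd_mul_pair P a b c d :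
  cd_mul P (cd_pair a b) (cd_pair c d) = cd_double (cd_mul P) P a b c d.
Proof.
pose n := (size (cd_pair a b) + size (cd_pair c d))%N.
have lt2 k : (k <= n -> k <= 2 ^ n.+1)%N.
  by move=> /leq_trans-> //; apply/ltnW/(ltn_trans (ltnSn n))/ltn_expl.
have szx := lt2 _ (leq_addr _ _ : size (cd_pair a b) <= n)%N.
have szy := lt2 _ (leq_addl _ _ : size (cd_pair c d) <= n)%N.
rewrite -(cd_mul_atE _ szx szy) /= !even_cd_pair !odd_cd_pair.
have := size_even_poly_exp szx; have := size_odd_poly_exp szx.
have := size_even_poly_exp szy; have := size_odd_poly_exp szy.
rewrite !even_cd_pair !odd_cd_pair => sd sc sb sa.
have szC z : (size z <= 2 ^ n)%N -> (size (cd_conj z) <= 2 ^ n)%N.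
  by apply: leq_trans; exact: size_poly.
by case: P; rewrite /cd_double !cd_mul_atE; auto.
Qed.

End CayleyDickson.

(* Main.v *)
Require Import Defs.
From Stdlib Require PeanoNat.
From mathcomp Require Import all_boot all_order all_algebra.
From mathcomp Require Import reals.

(** Doubling expresses [omega (i + 2p) (j + 2q)], for bits [i] and [j], as
    [omega p q] or [omega q p] up to a sign in which [p] and [q] only matter
    through whether they vanish (the sign of a conjugate).  If [p < 2 ^ N], then
    stripping the [N] low bits of [p] and of [r + c * 2 ^ N] leaves [0] and [c];
    as long as [c > 0] the second index never vanishes on the way, so every sign
    met is independent of [c], and at the end [omega 0 c = omega c 0 = 1]. *)

Import Order.TTheory GRing.Theory Num.Theory.
Local Open Scope ring_scope.

Lemma lxor_bit_double (i j : bool) (p q : nat) :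
  Nat.lxor (i + p.*2) (j + q.*2) = ((i (+) j) + (Nat.lxor p q).*2)%N.
Proof.
have bit0 (b : bool) n : Nat.testbit (b + n.*2) 0 = b.
  rewrite -mul2n -multE; case: b => /=; last exact: PeanoNat.Nat.testbit_even_0.
  by rewrite add1n -addn1; exact: PeanoNat.Nat.testbit_odd_0.
have bitS (b : bool) n k : Nat.testbit (b + n.*2) k.+1 = Nat.testbit n k.
  rewrite -mul2n -multE; case: b; last exact: PeanoNat.Nat.testbit_even_succ'.
  by rewrite addnC; exact: PeanoNat.Nat.testbit_odd_succ'.
apply: PeanoNat.Nat.bits_inj => -[|k].
  by rewrite PeanoNat.Nat.lxor_spec !bit0; case: i j => [] [].
by rewrite PeanoNat.Nat.lxor_spec !bitS PeanoNat.Nat.lxor_spec.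
Qed.

Section Product.
Variables (R : realType) (P : doubling_product).
Implicit Types x y : {poly R}.

(** The level built into [cd_mul] varies with its arguments; a shared level lets [cd_mul_atE]
    transfer identities from [cd_mul_at]. *)
Lemma common_level x y :
  exists n, (size x <= 2 ^ n)%N /\ (size y <= 2 ^ n)%N.
Proof.
exists (size x + size y)%N.
by split; apply: ltnW; apply: leq_ltn_trans (ltn_expl _ (ltnSn 1));
  rewrite ?leq_addr ?leq_addl.
Qed.

Lemma cd_mul_at0l n y : cd_mul_at P n 0 y = 0.
Proof.
(* With scalar [-1], linearity at [0] reads [m = - m + m], where [m] is the product in question. *)
have [+ _] := cd_mul_at_bilinear P n (-1) 0 0 y.
by rewrite scaler0 addr0 scaleN1r addNr.
Qed.

Lemma cd_mul_at0r n x : cd_mul_at P n x 0 = 0.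
Proof.
have [_ +] := cd_mul_at_bilinear P n (-1) 0 0 x.
by rewrite scaler0 addr0 scaleN1r addNr.
Qed.

Lemma cd_mulZl (r : R) x y : cd_mul P (r *: x) y = r *: cd_mul P x y.
Proof.
have [n [szx szy]] := common_level x y.
have szrx := leq_trans (size_scale_leq r x) szx.
rewrite -!(@cd_mul_atE _ P n) //.
have [+ _] := cd_mul_at_bilinear P n r x 0 y.
by rewrite cd_mul_at0l !addr0.
Qed.

Lemma cd_mulZr (r : R) x y : cd_mul P x (r *: y) = r *: cd_mul P x y.
Proof.
have [n [szx szy]] := common_level x y.
have szry := leq_trans (size_scale_leq r y) szy.
rewrite -!(@cd_mul_atE _ P n) //.
have [_ +] := cd_mul_at_bilinear P n r y 0 x.
by rewrite cd_mul_at0r !addr0.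
Qed.

Lemma cd_mul0l y : cd_mul P 0 y = 0.
Proof. by have := cd_mulZl 0 0 y; rewrite !scale0r. Qed.

Lemma cd_mul0r x : cd_mul P x 0 = 0.
Proof. by have := cd_mulZr 0 x 0; rewrite !scale0r. Qed.

Lemma cd_conj_basis k :
  cd_conj (cd_basis R k) = (if k == 0%N then 1 else -1) *: cd_basis R k.
Proof.
apply/polyP => i; rewrite coef_cd_conj coefZ !coefXn.
have [->|nik] := eqVneq i k; first by case: ifP; rewrite ?mul1r ?mulN1r.
by rewrite !mulr0 oppr0 if_same.
Qed.

Lemma cd_conj1 : cd_conj 1 = 1 :> {poly R}.
Proof. by have := cd_conj_basis 0; rewrite /cd_basis expr0 scale1r. Qed.

(** Since [1] is the pair [(1, 0)], in all eight formulas two terms vanish and the other two are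
    products with [1] one level down; only [1] is conjugated in them. *)
Lemma cd_mul_at1 n x : (size x <= 2 ^ n)%N ->
  cd_mul_at P n 1 x = x /\ cd_mul_at P n x 1 = x.
Proof.
have even1 : even_poly 1 = 1 :> {poly R} by rewrite -[1]/(1%:P) even_polyC.
have odd1 : odd_poly 1 = 0 :> {poly R} by rewrite -[1]/(1%:P) odd_polyC.
elim: n x => [|n IHn] x szx /=.
  by rewrite (size1_polyC szx) coef1 !coefC /= mul1r mulr1.
have [El Er] := IHn _ (size_even_poly_exp szx).
have [Ol Or] := IHn _ (size_odd_poly_exp szx).
rewrite even1 odd1 /cd_double.
by case: (P) El Er Ol Or (cd_mul_at0l n) (cd_mul_at0r n)
  => El Er Ol Or zl zr; rewrite !(cd_conj0, cd_conj1, zl, zr) ?El ?Er ?Ol ?Or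
    ?subr0 ?addr0 ?add0r cd_pairE.
Qed.

Lemma cd_mul1l x : cd_mul P 1 x = x.
Proof.
have [n [sz1 szx]] := common_level 1 x.
by rewrite -(@cd_mul_atE _ P n) //; case: (@cd_mul_at1 n x szx).
Qed.

Lemma cd_mul1r x : cd_mul P x 1 = x.
Proof.
have [n [sz1 szx]] := common_level 1 x.
by rewrite -(@cd_mul_atE _ P n) //; case: (@cd_mul_at1 n x szx).
Qed.

Lemma cd_basis_bit (b : bool) k :
  cd_basis R (b + k.*2) =
    cd_pair (if b then 0 else cd_basis R k) (if b then cd_basis R k else 0).
Proof. by case: b; [exact: cd_basis_doubleS | exact: cd_basis_double]. Qed.

Section Twist.
Variable omega : nat -> nat -> R.
Hypothesis homega : is_twist P omega.

Lemma twist_unique p q (r : R) :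
  cd_mul P (cd_basis R p) (cd_basis R q) = r *: cd_basis R (Nat.lxor p q) ->
  omega p q = r.
Proof.
have [_ ->] := homega p q.
move=> /(congr1 (fun x => x`_(Nat.lxor p q))).
by rewrite !coefZ coefXn eqxx !mulr1.
Qed.

Lemma twist0l q : omega 0 q = 1.
Proof.
by apply: twist_unique; rewrite PeanoNat.Nat.lxor_0_l scale1r cd_mul1l.
Qed.

Lemma twist0r p : omega p 0 = 1.
Proof.
by apply: twist_unique; rewrite PeanoNat.Nat.lxor_0_r scale1r cd_mul1r.
Qed.

(** Each basis element is a pair with one zero component, so a single term of the doubling formula
    survives. Choosing [r] and [swap] before [p] and [q] lets one choice serve several index
    pairs. *)
Lemma twist_double (i j p_eq0 q_eq0 : bool) : exists (r : R) (swap : bool),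
  forall p q, (p == 0)%N = p_eq0 -> (q == 0)%N = q_eq0 ->
  omega (i + p.*2)%N (j + q.*2)%N = r * (if swap then omega q p else omega p q).
Proof.
pose s (b : bool) : R := if b then 1 else -1.
(* The first four products conjugate the left factor, exactly in the terms containing [d]; the
   transposes conjugate the right factor, in those containing [b]. The term in [b] and [d] is
   subtracted. *)
exists (match P with
        | P0 | P1 | P2 | P3 => if j then if i then - s p_eq0 else s p_eq0 else 1
        | _ => if i then if j then - s q_eq0 else s q_eq0 else 1
        end).
(* The swap records whether the surviving term has the component of the right factor first. *)
exists (match P with
        | P0 => ~~ i | P1 => ~~ (j && ~~ i) | P2 => ~~ i && j | P3 => i
        | P0T => ~~ j | P1T => ~~ (i && ~~ j) | P2T => i && ~~ j | P3T => j
        end).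
move=> p q Ep Eq; apply: twist_unique.
rewrite lxor_bit_double !cd_basis_bit cd_mul_pair.
have mulpq := proj2 (homega p q); have mulqp := proj2 (homega q p).
rewrite PeanoNat.Nat.lxor_comm in mulqp.
have conjp := cd_conj_basis p; have conjq := cd_conj_basis q.
rewrite Ep -/(s _) in conjp; rewrite Eq -/(s _) in conjq.
case: P mulpq mulqp cd_mulZr cd_mulZl cd_mul0r cd_mul0l
  => mulpq mulqp mZr mZl m0r m0l; case: i; case: j => /=;
  rewrite ?(conjp, conjq, cd_conj0, mZl, mZr, m0l, m0r) ?mulpq ?mulqp
    ?(subr0, sub0r, addr0, add0r, mul1r, scaler0, oppr0) ?mulNr
    ?scalerA -cd_pairZ scaler0 ?scaleNr //.
Qed.

(** Both argument orders go through one induction because a doubling step may swap them. *)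
Lemma twist_high_bits N p r c d : (p < 2 ^ N)%N -> (0 < c)%N -> (0 < d)%N ->
  omega p (r + c * 2 ^ N)%N = omega p (r + d * 2 ^ N)%N /\
  omega (r + c * 2 ^ N)%N p = omega (r + d * 2 ^ N)%N p.
Proof.
move=> + c_gt0 d_gt0; elim: N p r => [|N IHN] p r ltp.
  by move: ltp; rewrite ltnS leqn0 => /eqP->; rewrite !twist0l !twist0r.
have split_bit e : (r + e * 2 ^ N.+1 = odd r + (r./2 + e * 2 ^ N).*2)%N.
  by rewrite doubleD addnA odd_double_half expnS mulnCA mul2n.
have nz e : (0 < e)%N -> (r./2 + e * 2 ^ N == 0)%N = false.
  by move=> e_gt0; rewrite addn_eq0 muln_eq0 expn_eq0 (gtn_eqF e_gt0) andbF.
have ltp2 : (p./2 < 2 ^ N)%N by rewrite ltn_half_double -mul2n -expnS.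
have [IHl IHr] := IHN p./2 r./2 ltp2.
rewrite !split_bit -(odd_double_half p).
(* By [nz] the flag [false] is right for both [c] and [d], so they share the sign and the swap. *)
have [u [s Hl]] := twist_double (odd p) (odd r) (p./2 == 0)%N false.
have [v [t Hr]] := twist_double (odd r) (odd p) false (p./2 == 0)%N.
by rewrite !Hl ?Hr ?nz // IHl IHr.
Qed.

End Twist.
End Product.

Theorem theorem2 (R : realType) (P : doubling_product)
    (omega : nat -> nat -> R) (homega : is_twist P omega)
    (p q k N : nat) (hN : (0 < N)%N)
    (hp : (2 ^ N.-1 <= p < 2 ^ N)%N) (hq : (2 ^ N <= q < 2 ^ N.+1)%N) :
  omega p q = omega p (q + k * 2 ^ N)%N.
Proof.
have [/andP[_ ltp] /andP[leq _]] := (hp, hq).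
(* Taking one [2 ^ N] out of [q] makes both multipliers positive: [1] for [q] and [k.+1] for the
   shifted index. *)
have [+ _] := @twist_high_bits R P omega homega N p (q - 2 ^ N) 1 k.+1 ltp isT isT.
by rewrite mul1n mulSn addnA subnK.
Qed.
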